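(* Fix $r \ge 1$ and positive integers $n_1, \dots, n_r$, and fix a label $v = (v_1,\dots,v_r)$ with $1 \le v_i \le n_i$ for all $i$. For each admissible $N$, let $\alpha$ be the number of balls that receive the label $v$ when $N$ balls are labelled by the First Way. Then the average (expected value) of $\alpha$ is exactly $$\frac{N}{\prod_{i=1}^r n_i},$$ and, as $N \to \infty$ through admissible values, its variance is $$\frac{N}{\prod_{i=1}^r n_i} - \frac{N}{\prod_{i=1}^r n_i^2}\left(1 + \sum_{i=1}^r (n_i - 1)\right) + O(1),$$ where the implied constant may depend on $r, n_1, \dots, n_r$ but not on $N$.
   Context: There are $N$ distinguishable balls. A label is an integer vector $(a_1,\dots,a_r)$ with $1 \le a_i \le n_i$ for each $i$. The positive integer $N$ is called admissible if it is divisible by $\mathrm{lcm}(n_1 n_2, n_2 n_3, \dots, n_{r-1} n_r)$ (for $r=1$, admissible means divisible by $n_1$). First Way (random labelling): for $i = 1, \dots, r$, independently of the other iterations, the set of all $N$ balls is distributed into $n_i$ pots numbered $1, \dots, n_i$, each pot receiving exactly $N/n_i$ balls, the distribution being chosen uniformly at random among all $N!/((N/n_i)!)^{n_i}$ such distributions. The $i$-th component $a_i$ of the label of a ball is the number of the pot into which the ball falls at iteration $i$. After each iteration all the balls are put back together before the next iteration. Thus the sample space consists of $\prod_{i=1}^r N!/((N/n_i)!)^{n_i}$ equally likely outcomes. The variance of a random variable $X$ is the expected value of $(X - E[X])^2$. *)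

(* Defs.v *)
From mathcomp Require Import all_boot all_order all_algebra.

Set Implicit Arguments.
Unset Strict Implicit.
Unset Printing Implicit Defensive.

Import GRing.Theory Num.Theory.
Local Open Scope ring_scope.

(* Balls are the elements of 'I_N.  Iterations are indexed by 'I_r and the
   pots of iteration i by 'I_(n i), so both are numbered from 0 instead of
   from 1. *)

Definition label (r : nat) (n : 'I_r -> nat) : finType :=
  {dffun forall i : 'I_r, 'I_(n i)}.

(* The conjunct for r = 1 is needed since the lcm is then empty, i.e. 1. *)
Definition admissible (r : nat) (n : 'I_r -> nat) (N : nat) : bool :=
  [&& (0 < N)%N,
      (\big[lcmn/1]_(p : 'I_r * 'I_r | p.2 == p.1.+1 :> nat) (n p.1 * n p.2)
         %| N)%N
    & (r == 1)%N ==> [forall i, n i %| N]%N].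

(* f b is the pot receiving the ball b. *)
Definition distributions (N m : nat) : {set {ffun 'I_N -> 'I_m}} :=
  [set f : {ffun 'I_N -> 'I_m} |
     [forall k : 'I_m, #|[set b : 'I_N | f b == k]| == (N %/ m)%N]].

Definition labelling (r : nat) (n : 'I_r -> nat) (N : nat) : finType :=
  {dffun forall i : 'I_r, {ffun 'I_N -> 'I_(n i)}}.

(* A full Cartesian product, so that the uniform law on it makes the
   iterations independent, each of them uniform. *)
Definition first_way (r : nat) (n : 'I_r -> nat) (N : nat) :
    {set labelling n N} :=
  [set w : labelling n N | [forall i, w i \in distributions N (n i)]].

Definition ball_label (r : nat) (n : 'I_r -> nat) (N : nat)
    (w : labelling n N) (b : 'I_N) : label n :=
  [ffun i => w i b].

Definition alpha (r : nat) (n : 'I_r -> nat) (N : nat) (v : label n)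
    (w : labelling n N) : nat :=
  #|[set b | ball_label w b == v]|.

(* Expectation and variance for the uniform law on the finite set Omega. *)
Definition expect (R : realFieldType) (T : finType) (Omega : {set T})
    (X : T -> R) : R :=
  (\sum_(w in Omega) X w) / #|Omega|%:R.

Definition var (R : realFieldType) (T : finType) (Omega : {set T})
    (X : T -> R) : R :=
  expect Omega (fun w => (X w - expect Omega X) ^+ 2).

(* Main.v *)
(* Write alpha as the sum over the balls b of the indicators [b has label v].
   The iterations are independent and, within one of them, the law of the
   distribution is invariant under permuting the balls.  Averaging over the
   balls, iteration i sends a given ball to pot v_i with probability 1 / n_i,
   and two given distinct balls with probability
   (N - n_i) / (n_i ^ 2 (N - 1)) = (1 - (n_i - 1) t) / n_i ^ 2,
   where t = 1 / (N - 1).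
   Hence E[alpha ^ 2] = N / P + N (N - 1) / P ^ 2 * \prod_i (1 - (n_i - 1) t)
   with P = \prod_i n_i, and replacing the last product by its first-order
   expansion 1 - t \sum_i (n_i - 1) costs N (N - 1) O(t ^ 2) = O(1). *)

Require Import Defs.
From mathcomp Require Import all_boot all_order all_algebra.
From mathcomp Require Import perm ring lra.

Set Implicit Arguments.
Unset Strict Implicit.
Unset Printing Implicit Defensive.

Import Order.TTheory GRing.Theory Num.Theory.
Local Open Scope ring_scope.

(** Coding dependent functions by [fprod], as functions into one tagged union, reduces this to
    distributivity for ordinary functions. *)
Lemma big_dffun_distr (R : comPzSemiRingType) (I : finType) (T : I -> finType)
    (F : forall i, T i -> R) :
  \sum_(w : {dffun forall i, T i}) \prod_i F i (w i) =
    \prod_i \sum_(x : T i) F i x.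
Proof.
rewrite (reindex (@dffun_of_fprod I T)); last exact/onW_bij/dffun_of_fprod_bij.
under eq_bigr => w _ do under eq_bigr => i _ do rewrite ffunE.
pose P i := [ffun x => F i x].
under eq_bigr => w _ do under eq_bigr => i _ do rewrite -[F i _]ffunE.
rewrite (big_fprod _ _ P).
(* [untag] gives the default 0 to elements whose tag is not [i]. *)
rewrite -(bigA_distr_big_dep _ (fun i => untag 0 (P i))).
apply: eq_bigr => i _; apply: etrans (esym (big_tag (fun i => P i) i)) _.
by apply: eq_bigr => x _; rewrite ffunE.
Qed.

(** * Linearity of expectation and the variance formula *)

Section Expect.
Variables (R : realFieldType) (T : finType) (Omega : {set T}).
Implicit Types X Y : T -> R.

Lemma eq_expect X Y : {in Omega, X =1 Y} -> expect Omega X = expect Omega Y.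
Proof. by move=> eqXY; congr (_ / _); apply: eq_bigr. Qed.

Lemma expect_sum (I : finType) (P : pred I) (X : I -> T -> R) :
  expect Omega (fun w => \sum_(i | P i) X i w) =
    \sum_(i | P i) expect Omega (X i).
Proof. by rewrite /expect exchange_big mulr_suml. Qed.

Lemma expectZr X a : expect Omega (fun w => X w * a) = expect Omega X * a.
Proof. by rewrite /expect -mulr_suml mulrAC. Qed.

Lemma expect_cst a : Omega != set0 -> expect Omega (fun=> a) = a :> R.
Proof.
move=> Omega0; rewrite /expect sumr_const -[a *+ _]mulr_natr mulfK //.
by rewrite pnatr_eq0 cards_eq0.
Qed.

Lemma varE X : Omega != set0 ->
  var Omega X = expect Omega (fun w => X w ^+ 2) - expect Omega X ^+ 2.
Proof.
move=> Omega0; rewrite /var; set m := expect Omega X.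
have -> : expect Omega (fun w => (X w - m) ^+ 2) =
    expect Omega (fun w => X w ^+ 2) - expect Omega X * (m *+ 2)
      + expect Omega (fun=> m ^+ 2).
  rewrite /expect mulrAC -mulrBl -mulrDl; congr (_ / _).
  rewrite mulr_suml -sumrB -big_split /=; apply: eq_bigr => w _.
  by rewrite sqrrB mulrnAr.
rewrite expect_cst // -/m; ring.
Qed.

End Expect.

(** Independence of the iterations: over a Cartesian product, both the sum and the cardinality
    factor. *)
Lemma expect_first_way (R : realFieldType) (r : nat) (n : 'I_r -> nat)
    (N : nat) (F : forall i, {ffun 'I_N -> 'I_(n i)} -> R) :
  expect (first_way n N) (fun w => \prod_i F i (w i)) =
    \prod_i expect (distributions N (n i)) (F i).
Proof.
have sumE (G : forall i, {ffun 'I_N -> 'I_(n i)} -> R) :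
    \sum_(w in first_way n N) \prod_i G i (w i) =
    \prod_i \sum_(f in distributions N (n i)) G i f.
  under [RHS]eq_bigr => i _ do rewrite big_mkcond.
  rewrite -(big_dffun_distr
    (fun i f => if f \in distributions N (n i) then G i f else 0)).
  rewrite big_mkcond; apply: eq_bigr => w _; rewrite inE.
  (* Outside [first_way] some component leaves its set of distributions, and its factor 0 kills the
     product. *)
  case: ifPn => [/forallP wD|]; first by apply: eq_bigr => i _; rewrite wD.
  by case/forallPn=> i /negPf wDi; rewrite (bigD1 i) //= wDi mul0r.
have -> : \prod_i expect (distributions N (n i)) (F i) =
    (\prod_i \sum_(f in distributions N (n i)) F i f)
    / \prod_i #|distributions N (n i)|%:R.
  by rewrite -prodf_div.
congr (_ / _); first exact: sumE.
(* The cardinalities are the case of [sumE] with all factors 1. *)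
rewrite -sumr_const; under [RHS]eq_bigr do rewrite -sumr_const.
by rewrite -sumE; apply: eq_bigr => w _; rewrite big1_eq.
Qed.

(** * A single iteration: the pots of one ball and of two balls *)

Section OneIteration.
Variables (R : realFieldType) (N m : nat).
Hypotheses (N_gt0 : (0 < N)%N) (m_dvd_N : (m %| N)%N).
Let D := distributions N m.

Let natrN : N%:R = (N %/ m)%:R * m%:R :> R.
Proof. by rewrite -natrM divnK. Qed.

Let m_neq0 : m%:R != 0 :> R.
Proof. by rewrite pnatr_eq0 -lt0n (dvdn_gt0 N_gt0). Qed.

Let N_neq0 : N%:R != 0 :> R.
Proof. by rewrite pnatr_eq0 -lt0n. Qed.

(** As m divides N, the balls can be numbered by pairs (pot, place in the pot); the first projection
    is a distribution. *)
Lemma distributions_neq0 : D != set0.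
Proof.
have eN : N = #|{: 'I_m * 'I_(N %/ m)}|.
  by rewrite card_prod !card_ord mulnC divnK.
apply/set0Pn; exists [ffun b => (enum_val (cast_ord eN b)).1].
rewrite inE; apply/forallP => k; apply/eqP.
pose g (j : 'I_(N %/ m)) : 'I_N := cast_ord (esym eN) (enum_rank (k, j)).
have g_inj : injective g.
  by move=> j1 j2 /cast_ord_inj/enum_rank_inj[].
rewrite -[RHS]card_ord -(card_imset _ g_inj); apply: eq_card => b.
rewrite inE ffunE; apply/eqP/imsetP => [bk|[j _ ->]]; last first.
  by rewrite cast_ordKV enum_rankK.
exists (enum_val (cast_ord eN b)).2 => //.
by rewrite /g -bk -surjective_pairing enum_valK cast_ordK.
Qed.

Lemma sum_pot (f : {ffun 'I_N -> 'I_m}) (k : 'I_m) : f \in D ->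
  \sum_b (f b == k)%:R = (N %/ m)%:R :> R.
Proof.
rewrite inE => /forallP/(_ k)/eqP <-.
rewrite -sum1dep_card natr_sum [RHS]big_mkcond.
by apply: eq_bigr => b _; case: eqP.
Qed.

(** Permuting the balls preserves pot sizes, hence acts bijectively on [D]. *)
Lemma expect_perm (s : {perm 'I_N}) (X : {ffun 'I_N -> 'I_m} -> R) :
  expect D (fun f => X [ffun b => f (s b)]) = expect D X.
Proof.
rewrite /expect; congr (_ / _).
pose h (u : {perm 'I_N}) (f : {ffun 'I_N -> 'I_m}) := [ffun b => f (u b)].
have h_bij : bijective (h s).
  by exists (h s^-1%g) => f; apply/ffunP => b; rewrite !ffunE ?permK ?permKV.
rewrite [RHS](reindex (h s)); last exact/onW_bij.
apply: eq_bigl => f; rewrite !inE; apply: eq_forallb => k.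
rewrite -(card_imset [set b | h s f b == k] (@perm_inj _ s)).
congr (_ == _); apply: eq_card => b; rewrite inE.
apply/idP/imsetP => [fb|[c + ->]]; last by rewrite inE ffunE.
by exists ((s^-1)%g b); rewrite ?inE ?ffunE permKV.
Qed.

Lemma expect_pot (b : 'I_N) (k : 'I_m) :
  expect D (fun f => (f b == k)%:R) = m%:R^-1 :> R.
Proof.
have sym (c : 'I_N) : expect D (fun f => (f c == k)%:R) =
    expect D (fun f => (f b == k)%:R) :> R.
  rewrite -(expect_perm (tperm b c)); apply: eq_expect => f _.
  by rewrite ffunE tpermR.
have : \sum_(c : 'I_N) expect D (fun f => (f c == k)%:R) = (N %/ m)%:R :> R.
  rewrite -expect_sum (eq_expect (Y := fun=> (N %/ m)%:R)).
    exact/expect_cst/distributions_neq0.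
  by move=> f fD; rewrite sum_pot.
under eq_bigr do rewrite sym.
rewrite sumr_const card_ord -[_ *+ N]mulr_natr => E.
apply: (mulIf N_neq0); rewrite E natrN; field.
exact: m_neq0.
Qed.

(** If [b] lies in pot [k], so do exactly N/m - 1 of the N - 1 other balls, and by symmetry each of
    these is equally likely to do so. *)
Lemma expect_pot2 (b c : 'I_N) (k : 'I_m) : b != c ->
  expect D (fun f => (f b == k)%:R * (f c == k)%:R) =
    (N%:R - m%:R) / (m%:R ^+ 2 * (N%:R - 1)) :> R.
Proof.
move=> neq_bc.
have sym (d : 'I_N) : d != b ->
    expect D (fun f => (f b == k)%:R * (f d == k)%:R) =
    expect D (fun f => (f b == k)%:R * (f c == k)%:R) :> R.
  (* The transposition of [c] and [d] fixes [b]. *)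
  move=> neq_db; rewrite -(expect_perm (tperm c d)); apply: eq_expect => f _.
  by rewrite !ffunE tpermR tpermD // eq_sym.
have : \sum_(d | d != b) expect D (fun f => (f b == k)%:R * (f d == k)%:R) =
    m%:R^-1 * ((N %/ m)%:R - 1) :> R.
  rewrite -expect_sum -(expect_pot b k) -expectZr; apply: eq_expect => f fD.
  have := sum_pot k fD; rewrite (bigD1 b) //= -mulr_sumr => <-.
  by case: (f b == k); rewrite ?mul0r // !mul1r addrAC subrr add0r.
rewrite (eq_bigr _ sym) sumr_const cardC1 card_ord.
rewrite -[_ *+ N.-1]mulr_natr -subn1 natrB // => E.
(* Two distinct balls exist, so N is not 1. *)
have N1 : N%:R - 1 != 0 :> R.
  rewrite subr_eq0 pnatr_eq1 gtn_eqF //.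
  by have := max_card [set b; c]; rewrite cards2 neq_bc card_ord.
move: E (N1); rewrite natrN; set q := (N %/ m)%:R => E qm1.
by apply: (mulIf qm1); rewrite E; field; rewrite qm1; apply: m_neq0.
Qed.

End OneIteration.

(** An index [i] has a successor or a predecessor, so [n i] divides one of the products in the lcm,
    unless r = 1. *)
Lemma admissible_dvd (r : nat) (n : 'I_r -> nat) (N : nat) (i : 'I_r) :
  admissible n N -> (n i %| N)%N.
Proof.
case/and3P=> _ lcmN r1N.
have dvd (p : 'I_r * 'I_r) : p.2 == p.1.+1 :> nat -> (n p.1 * n p.2 %| N)%N.
  by move=> pP; apply: dvdn_trans lcmN; rewrite (bigD1 p) //= dvdn_lcml.
have [i1r|] := ltnP i.+1 r.
  exact: dvdn_trans (dvdn_mulr _ (dvdnn _)) (dvd (i, Ordinal i1r) (eqxx _)).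
case: (posnP i) => [i0 | i_gt0] le_r_i.
  have r1 : r == 1%N.
    by rewrite eqn_leq (leq_ltn_trans _ (ltn_ord i)) // andbT -[1%N]/(0.+1) -i0.
  by move: r1N; rewrite r1 => /forallP.
have i1r : (i.-1 < r)%N by rewrite (leq_ltn_trans (leq_pred _)).
have := dvd (Ordinal i1r, i); rewrite /= prednK // eqxx => /(_ isT).
exact/dvdn_trans/dvdn_mull.
Qed.

Lemma first_way_neq0 (r : nat) (n : 'I_r -> nat) (N : nat) :
  admissible n N -> first_way n N != set0.
Proof.
move=> adm; have N_gt0 : (0 < N)%N by case/and3P: adm.
have D0 i : {f | f \in distributions N (n i)}.
  by have /set0Pn/sigW := distributions_neq0 (admissible_dvd i adm).
apply/set0Pn; exists [ffun i => sval (D0 i)].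
by rewrite inE; apply/forallP => i; rewrite ffunE; exact: (svalP (D0 i)).
Qed.

Lemma alphaE (R : comPzSemiRingType) (r : nat) (n : 'I_r -> nat) (N : nat)
    (v : label n) (w : labelling n N) :
  (alpha v w)%:R = \sum_b \prod_i (w i b == v i)%:R :> R.
Proof.
rewrite /alpha -sum1dep_card natr_sum big_mkcond; apply: eq_bigr => b _.
case: ifPn => [/eqP <-|neq].
  by rewrite big1 // => i _; rewrite ffunE eqxx.
have /forallPn[i /negPf wi] : ~~ [forall i, w i b == v i].
  apply: contra neq => /forallP eq; apply/eqP/ffunP => i.
  by rewrite ffunE; apply/eqP.
by apply/esym; rewrite (bigD1 i) //= wi; apply: mul0r.
Qed.

(** The first-order expansion, with [K] independent of [t]; induction on the factors. *)
Lemma prod_1subM_bound (R : realDomainType) (I : Type) (s : seq I) (a : I -> R) :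
  exists K, forall t, 0 <= t <= 1 ->
    `|\prod_(i <- s) (1 - a i * t) - (1 - t * \sum_(i <- s) a i)| <= K * t ^+ 2.
Proof.
elim: s => [|i s [K IH]].
  by exists 0 => t _; rewrite !big_nil mulr0 subr0 subrr normr0 mul0r.
(* The first summand bounds |1 - a t| times the previous error; the second comes from the new cross
   term of order t^2. *)
exists ((1 + `|a i|) * K + `|a i * \sum_(j <- s) a j|) => t t01.
rewrite !big_cons; move: (IH t t01).
set G := \prod_(j <- s) _; set S := \sum_(j <- s) _ => IHt.
have -> : (1 - a i * t) * G - (1 - t * (a i + S)) =
    (1 - a i * t) * (G - (1 - t * S)) + a i * S * t ^+ 2 by ring.
rewrite [leRHS]mulrDl (le_trans (ler_normD _ _)) // lerD //; last first.
  by rewrite normrM (ger0_norm (sqr_ge0 t)).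
rewrite normrM -mulrA ler_pM // (le_trans (ler_normB _ _)) // normr1 lerD2l normrM.
by case/andP: t01 => t0 t1; rewrite ler_piMr // ger0_norm.
Qed.

(** * First and second moments of [alpha] *)

Section Moments.
Variables (R : realFieldType) (r : nat) (n : 'I_r -> nat) (N : nat).
Hypothesis adm : admissible n N.
Variable v : label n.
Let X := fun w : labelling n N => (alpha v w)%:R : R.

Let N_gt0 : (0 < N)%N.
Proof. by case/and3P: adm. Qed.

Lemma expect_alpha : expect (first_way n N) X = N%:R / \prod_i (n i)%:R.
Proof.
under [LHS]eq_expect => w _ do rewrite /X alphaE.
rewrite expect_sum -prodfV mulr_natl -[N in RHS]card_ord -sumr_const.
apply: eq_bigr => b _.
rewrite (expect_first_way (fun i f => (f b == v i)%:R)).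
by apply: eq_bigr => i _; rewrite expect_pot // (admissible_dvd _ adm).
Qed.

Lemma expect_alpha2 : expect (first_way n N) (fun w => X w ^+ 2) =
  N%:R / \prod_i (n i)%:R + N%:R * (N%:R - 1) *
    \prod_i ((N%:R - (n i)%:R) / ((n i)%:R ^+ 2 * (N%:R - 1))).
Proof.
pose Y (b : 'I_N) i (f : {ffun 'I_N -> 'I_(n i)}) : R := (f b == v i)%:R.
have YM b c (w : labelling n N) : (\prod_i Y b i (w i)) * (\prod_i Y c i (w i)) =
  \prod_i (Y b i (w i) * Y c i (w i)) by rewrite big_split.
(* Indicators are idempotent, so the diagonal pairs of balls give back [X]. *)
have sqE w : X w ^+ 2 =
    X w + \sum_b \sum_(c | c != b) \prod_i (Y b i (w i) * Y c i (w i)).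
  rewrite expr2 /X alphaE big_distrlr -big_split; apply: eq_bigr => b _ /=.
  rewrite (bigD1 b) //=; congr (_ + _).
    rewrite -big_split; apply: eq_bigr => i _ /=.
    by case: eqP; rewrite ?mulr1 ?mulr0.
  by apply: eq_bigr => c _; rewrite YM.
transitivity (expect (first_way n N) X + \sum_b \sum_(c | c != b)
    expect (first_way n N) (fun w => \prod_i (Y b i (w i) * Y c i (w i)))).
  under [LHS]eq_expect => w _ do rewrite sqE.
  rewrite {1}/expect big_split mulrDl; congr (_ + _).
  rewrite -[LHS]/(expect _ _) expect_sum; apply: eq_bigr => b _.
  exact: expect_sum.
rewrite expect_alpha; congr (_ + _).
set p := \prod_i _.
have pE b c : c != b ->
    expect (first_way n N) (fun w => \prod_i (Y b i (w i) * Y c i (w i))) = p.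
  move=> cb; rewrite (expect_first_way (fun i f => Y b i f * Y c i f)).
  apply: eq_bigr => i _; apply: expect_pot2 => //; last by rewrite eq_sym.
  exact: admissible_dvd adm.
under eq_bigr => b _ do rewrite (eq_bigr _ (pE b)) sumr_const cardC1 card_ord.
rewrite sumr_const card_ord -[_ *+ N]mulr_natl -[_ *+ N.-1]mulr_natl.
by rewrite -subn1 natrB // mulrA.
Qed.

End Moments.

Theorem proposition1 (R : realFieldType) (r : nat) (n : 'I_r -> nat)
    (hr : (0 < r)%N) (hn : forall i : 'I_r, (0 < n i)%N) :
  (forall (v : label n) (N : nat), admissible n N ->
     expect (first_way n N) (fun w => (alpha v w)%:R : R) =
       N%:R / \prod_(i < r) (n i)%:R)
  /\
  (exists (C : R) (N0 : nat), forall (v : label n) (N : nat),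
     admissible n N -> (N0 <= N)%N ->
     `| var (first_way n N) (fun w => (alpha v w)%:R : R)
        - (N%:R / \prod_(i < r) (n i)%:R
           - N%:R / \prod_(i < r) (n i)%:R ^+ 2
             * (1 + \sum_(i < r) ((n i)%:R - 1))) | <= C).
Proof.
split=> [v N adm|]; first exact: expect_alpha.
have [K Kbound] := prod_1subM_bound (index_enum 'I_r) (fun i => (n i)%:R - 1 : R).
(* N >= 2 puts t = 1/(N - 1) in [0, 1], and the 2 bounds N t = N/(N - 1). *)
exists (2 * K / \prod_(i < r) (n i)%:R ^+ 2), 2 => v N adm N2.
rewrite varE ?first_way_neq0 // expect_alpha // expect_alpha2 //.
set P := \prod_(i < r) (n i)%:R; set P2 := \prod_(i < r) (n i)%:R ^+ 2.
have PP : P ^+ 2 = P2 by rewrite /P -prodrXl.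
have n0 i : (n i)%:R != 0 :> R by rewrite pnatr_eq0 -lt0n.
have P0 : P != 0 by apply/prodf_neq0 => i _.
have P20 : 0 < P2 by apply: prodr_gt0 => i _; rewrite exprn_gt0 // ltr0n.
have N2R : 2 <= N%:R :> R by rewrite ler_nat.
set t := (N%:R - 1)^-1 : R.
have N1_gt0 : 0 < N%:R - 1 :> R by lra.
have t01 : 0 <= t <= 1.
  by rewrite invr_ge0 ltW //= invf_le1 //; lra.
have -> : \prod_i ((N%:R - (n i)%:R) / ((n i)%:R ^+ 2 * (N%:R - 1))) =
    \prod_i (1 - ((n i)%:R - 1) * t) / P2.
  rewrite -prodf_div; apply: eq_bigr => i _; rewrite /t; field.
  by rewrite n0 gt_eqF.
have {Kbound} := Kbound t t01.
set G := \prod_i _; set S := \sum_i _ => Kbound.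
(* Since (N - 1) t = 1, the main terms cancel exactly, leaving only the expansion error of the
   product. *)
have -> : N%:R / P + N%:R * (N%:R - 1) * (G / P2) - (N%:R / P) ^+ 2
    - (N%:R / P - N%:R / P2 * (1 + S)) =
    N%:R * (N%:R - 1) / P2 * (G - (1 - t * S)).
  by rewrite -PP /t; field; rewrite P0 gt_eqF.
have t_gt0 : 0 < t by rewrite invr_gt0.
(* [K] t^2 bounds an absolute value and t > 0; the sign lets N t <= 2 be multiplied by [K / P2]. *)
have K0 : 0 <= K.
  rewrite -(pmulr_lge0 _ (exprn_gt0 2 t_gt0)).
  exact: le_trans (normr_ge0 _) Kbound.
have c0 : 0 <= N%:R * (N%:R - 1) / P2.
  by rewrite divr_ge0 ?mulr_ge0 ?ler0n // ltW.
rewrite normrM (ger0_norm c0) (le_trans (ler_wpM2l c0 Kbound)) //.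
have -> : N%:R * (N%:R - 1) / P2 * (K * t ^+ 2) = N%:R * t * (K / P2).
  by rewrite /t; field; rewrite !gt_eqF.
rewrite -[leRHS]mulrA ler_wpM2r ?divr_ge0 ?(ltW P20) //.
by rewrite ler_pdivrMr //; lra.
Qed.
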